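(* Let $\gamma_1,\gamma_2$ be constants, each real or purely imaginary, let $f\in(0,\pi/2)$, and put $k_1=\cos f$, $k_2=\sin f$. On $T^*\mathbb{R}^2$ with canonical coordinates $(q_1,q_2,p_1,p_2)$ and $\omega=dq_1\wedge dp_1+dq_2\wedge dp_2$, let $$H_{(2)}=p_1^2+p_2^2+\gamma_1(q_1p_1+q_2p_2)+\gamma_2(q_1p_1+q_2p_2)^2,\quad \mathcal J=q_1p_2-q_2p_1,$$ $$I_2=\bigl(1+\gamma_2(q_1^2+q_2^2)\bigr)p_2^2+\gamma_1q_2p_2,\quad I_e=-\gamma_2k_1^2\,\mathcal J^2-k_2^2\,I_2,$$ and $$K_{\mathcal J^2}=\begin{pmatrix}q_2^2&-q_1q_2&0&0\\-q_1q_2&q_1^2&0&0\\0&-\mathcal J&q_2^2&-q_1q_2\\\mathcal J&0&-q_1q_2&q_1^2\end{pmatrix},\qquad K_{I_2}=\begin{pmatrix}0&0&0&0\\-\gamma_2q_1q_2&1+\gamma_2q_1^2&0&0\\0&-\gamma_2q_1p_2&0&-\gamma_2q_1q_2\\\gamma_2q_1p_2&0&0&1+\gamma_2q_1^2\end{pmatrix}.$$ The operator $$K_e=-\gamma_2k_1^2\,K_{\mathcal J^2}-k_2^2\,K_{I_2}$$ is Haantjes, i.e. its Haantjes torsion satisfies $\mathcal H_{K_e}\equiv0$. Together with the identity operator it generates a semisimple Abelian $\omega\mathscr H$ structure for the pair $(H_{(2)},I_e)$.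
   Context: Matrices of operators are written with respect to the frame $\partial_{q_1},\partial_{q_2},\partial_{p_1},\partial_{p_2}$. For a $(1,1)$ tensor field $L$, the Nijenhuis torsion is $T_L(X,Y)=L^2[X,Y]+[LX,LY]-L([X,LY]+[LX,Y])$ and the Haantjes torsion is $\mathcal H_L(X,Y)=L^2T_L(X,Y)+T_L(LX,LY)-L(T_L(X,LY)+T_L(LX,Y))$. An $\omega\mathscr H$ (symplectic-Haantjes) structure on a symplectic manifold $(M,\omega)$ is given by a Haantjes algebra $\mathscr H$, i.e. a set of Haantjes operators closed under $C^\infty(M)$-linear combinations and under composition and generated by finitely many independent operators, each $K\in\mathscr H$ being compatible with $\omega$: $\Omega K=K^T\Omega$, with $\Omega:TM\to T^*M$ defined by $\omega(X,Y)=\langle\Omega X,Y\rangle$. It is Abelian if its operators commute pairwise. A Haantjes operator is semisimple if algebraic and geometric multiplicity coincide for every eigenvalue, equivalently if it admits a local frame of eigenvectors. The structure is for the pair $(H_{(2)},I_e)$ in the sense that the chain equation $K_e^T\,dH_{(2)}=dI_e$ holds.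
   Formalization: Semisimplicity is proved on a common open dense set of points, not at every point: for nonzero gamma_2 it fails where eigenvalues collide, e.g. gamma_2>0, q_1=0, gamma_2 k_1^2 q_2^2=k_2^2, p_1 nonzero. Functions and fields are complex-valued. *)

(* Defs.v *)
From HB Require Import structures.
From mathcomp Require Import all_boot all_order all_algebra.
From mathcomp Require Import all_classical all_reals all_analysis.
From mathcomp Require Import complex.

Set Implicit Arguments.
Unset Strict Implicit.
Unset Printing Implicit Defensive.

Import Order.TTheory GRing.Theory Num.Theory.
Import numFieldNormedType.Exports.

Local Open Scope classical_set_scope.
Local Open Scope ring_scope.
Local Open Scope complex_scope.

(* The base manifold is the real manifold T^*R^2 = R^4, a point being the row
   (q1, q2, p1, p2).  Since the parameters may be purely imaginary, functions
   are complex valued and vector fields, covector fields and operators are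
   sections of the complexified bundles, given by their components in the
   coordinate frame.  Vectors and covectors are columns. *)
Definition phase (R : realType) := 'rV[R]_4.
Definition cfun (R : realType) := phase R -> R[i].
Definition vfield (R : realType) := phase R -> 'cV[R[i]]_4.
Definition operator (R : realType) := phase R -> 'M[R[i]]_4.

Section Calculus.
Variable R : realType.
Implicit Types (x : phase R) (F G : cfun R) (X Y : vfield R) (L : operator R).

Definition dir (j : 'I_4) : phase R := delta_mx 0 j.

(* Class C^n: all iterated partial derivatives up to order n exist and those of
   order n are continuous. *)
Fixpoint Ck (n : nat) (u : phase R -> R) : Prop :=
  if n is m.+1 then
    forall j : 'I_4, (forall x, derivable u x (dir j)) /\
                     Ck m (fun x => 'D_(dir j) u x)
  else continuous u.

Definition smooth F : Prop :=
  forall n, Ck n (fun x => complex.Re (F x)) /\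
            Ck n (fun x => complex.Im (F x)).

Definition smooth_vfield X : Prop := forall i, smooth (fun x => X x i 0).
Definition smooth_operator L : Prop := forall i j, smooth (fun x => L x i j).

(* Derivative of a complex-valued function of real variables, taken on the real
   and imaginary parts. *)
Definition partial (j : 'I_4) F : cfun R := fun x =>
  'D_(dir j) (fun y => complex.Re (F y)) x +i*
  'D_(dir j) (fun y => complex.Im (F y)) x.

Definition differential F : vfield R := fun x => \col_i partial i F x.

Definition lie_bracket X Y : vfield R := fun x =>
  \col_i \sum_(j < 4) (X x j 0 * partial j (fun y => Y y i 0) x
                     - Y x j 0 * partial j (fun y => X y i 0) x).

Definition app L X : vfield R := fun x => L x *m X x.

Definition nijenhuis L X Y : vfield R := fun x =>
  app L (app L (lie_bracket X Y)) x + lie_bracket (app L X) (app L Y) x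
  - app L (fun y => lie_bracket X (app L Y) y + lie_bracket (app L X) Y y) x.

Definition haantjes L X Y : vfield R := fun x =>
  app L (app L (nijenhuis L X Y)) x + nijenhuis L (app L X) (app L Y) x
  - app L (fun y => nijenhuis L X (app L Y) y + nijenhuis L (app L X) Y y) x.

Definition haantjes_operator L : Prop :=
  smooth_operator L /\
  forall X Y, smooth_vfield X -> smooth_vfield Y ->
    forall x, haantjes L X Y x = 0.

End Calculus.

Section Symplectic.
Variable R : realType.

(* omega = dq1 /\ dp1 + dq2 /\ dp2; the indices 0, 1, 2, 3 are q1, q2, p1, p2. *)
Definition omega (X Y : 'cV[R[i]]_4) : R[i] :=
  (X 0 0 * Y 2 0 - X 2 0 * Y 0 0) + (X 1 0 * Y 3 0 - X 3 0 * Y 1 0).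

(* The matrix of Omega, so that omega X Y = (Omega *m X)^T *m Y. *)
Definition Omega : 'M[R[i]]_4 :=
  \matrix_(i, j) omega (delta_mx j 0) (delta_mx i 0).

Definition omega_compatible (L : operator R) : Prop :=
  forall x, Omega *m L x = (L x)^T *m Omega.

Definition lincomb_closed (A : set (operator R)) : Prop :=
  forall (F G : cfun R) (K L : operator R), smooth F -> smooth G ->
    A K -> A L -> A (fun x => F x *: K x + G x *: L x).

Definition comp_closed (A : set (operator R)) : Prop :=
  forall K L : operator R, A K -> A L -> A (fun x => K x *m L x).

(* The algebra generated by S: the least set of operators containing S and
   closed under smooth linear combinations and composition. *)
Definition gen_algebra (S : set (operator R)) : set (operator R) :=
  [set K | forall A : set (operator R),
     lincomb_closed A -> comp_closed A -> S `<=` A -> A K].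

(* Linear independence over the ring of smooth functions. *)
Definition independent m (B : 'I_m -> operator R) : Prop :=
  forall F : 'I_m -> cfun R, (forall i, smooth (F i)) ->
    (forall x, \sum_(i < m) F i x *: B i x = 0) ->
    forall i x, F i x = 0.

(* A Haantjes algebra is a free module of finite rank over the smooth
   functions; B is a basis of it. *)
Definition haantjes_algebra m (B : 'I_m -> operator R)
    (A : set (operator R)) : Prop :=
  [/\ forall K, A K -> haantjes_operator K,
      lincomb_closed A /\ comp_closed A,
      forall i, A (B i),
      independent B &
      forall K, A K -> exists2 F : 'I_m -> cfun R, (forall i, smooth (F i)) &
        forall x, K x = \sum_(i < m) F i x *: B i x].

Definition omegaH_structure m (B : 'I_m -> operator R)
    (A : set (operator R)) : Prop :=
  haantjes_algebra B A /\ forall K, A K -> omega_compatible K.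

Definition abelian_algebra (A : set (operator R)) : Prop :=
  forall K L, A K -> A L -> forall x, K x *m L x = L x *m K x.

(* MathComp's eigenspaces consist of row vectors acted on from the right,
   whence the transposes. *)
Definition semisimple_mx (M : 'M[R[i]]_4) : Prop :=
  forall l : R[i], eigenvalue M^T l ->
    mup l (char_poly M) = \rank (eigenspace M^T l).

(* Semisimplicity of operator fields is a generic property, i.e. it is required
   on a dense open subset of the manifold, here one common to all the operators
   of the algebra.  It fails pointwise on the exceptional set where eigenvalues
   collide: for instance at q1 = 0, gamma2 (k1 q2)^2 = k2^2, p1 <> 0 (with
   gamma2 > 0) the operator Ke below has a single eigenvalue without being scalar. *)
Definition semisimple_algebra (A : set (operator R)) : Prop :=
  exists U : set (phase R), [/\ open U, dense U &
    forall K, A K -> forall x, U x -> semisimple_mx (K x)].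

Definition chain_equation (K : operator R) (F G : cfun R) : Prop :=
  forall x, (K x)^T *m differential F x = differential G x.

End Symplectic.

Section System.
Variables (R : realType) (g1 g2 : R[i]) (f : R).

Definition real_or_imaginary (z : R[i]) : Prop :=
  complex.Im z = 0 \/ complex.Re z = 0.

Definition mx_of_rows (rows : seq (seq R[i])) : 'M[R[i]]_4 :=
  \matrix_(i, j) nth 0 (nth [::] rows i) j.

Definition q1 : cfun R := fun x => (x 0 0)%:C.
Definition q2 : cfun R := fun x => (x 0 1)%:C.
Definition p1 : cfun R := fun x => (x 0 2)%:C.
Definition p2 : cfun R := fun x => (x 0 3)%:C.

Definition k1 : R[i] := (cos f)%:C.
Definition k2 : R[i] := (sin f)%:C.

Definition H2 : cfun R := fun x =>
  p1 x ^+ 2 + p2 x ^+ 2 + g1 * (q1 x * p1 x + q2 x * p2 x)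
  + g2 * (q1 x * p1 x + q2 x * p2 x) ^+ 2.

Definition J : cfun R := fun x => q1 x * p2 x - q2 x * p1 x.

Definition I2 : cfun R := fun x =>
  (1 + g2 * (q1 x ^+ 2 + q2 x ^+ 2)) * p2 x ^+ 2 + g1 * q2 x * p2 x.

Definition Ie : cfun R := fun x =>
  - g2 * k1 ^+ 2 * J x ^+ 2 - k2 ^+ 2 * I2 x.

Definition KJ2 : operator R := fun x => mx_of_rows
  [:: [:: q2 x ^+ 2;     - q1 x * q2 x; 0;             0];
      [:: - q1 x * q2 x; q1 x ^+ 2;     0;             0];
      [:: 0;             - J x;         q2 x ^+ 2;     - q1 x * q2 x];
      [:: J x;           0;             - q1 x * q2 x; q1 x ^+ 2]].

Definition KI2 : operator R := fun x => mx_of_rows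
  [:: [:: 0;                  0;                    0; 0];
      [:: - g2 * q1 x * q2 x; 1 + g2 * q1 x ^+ 2;   0; 0];
      [:: 0;                  - g2 * q1 x * p2 x;   0; - g2 * q1 x * q2 x];
      [:: g2 * q1 x * p2 x;   0;                    0; 1 + g2 * q1 x ^+ 2]].

Definition Ke : operator R := fun x =>
  (- g2 * k1 ^+ 2) *: KJ2 x - k2 ^+ 2 *: KI2 x.

Definition Kid : operator R := fun=> 1%:M.

Definition generators : 'I_2 -> operator R :=
  fun i => if i == 0 then Kid else Ke.

End System.

(* Main.v *)
From HB Require Import structures.
Require Import Defs.
From mathcomp Require Import all_boot all_order all_algebra.
From mathcomp Require Import all_classical all_reals all_analysis.
From mathcomp Require Import complex ring.
Import Order.TTheory GRing.Theory Num.Theory.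
Import numFieldNormedType.Exports.
Local Open Scope classical_set_scope.
Local Open Scope ring_scope.

(** At a point, the Haantjes torsion of L is an algebraic expression [htorsion]
    in the value of L and its directional derivatives.  It is additive in the
    derivatives, vanishes when these are scalar multiples of an operator
    commuting with L, and is unaffected by shifting L by a scalar; hence the
    torsion of F + G K is G^4 times that of K.  With a = -g2 k1^2, b = -k2^2,
    c = a + b g2 the operator K = Ke is a polynomial matrix whose torsion
    vanishes for all a, b, c, and K^2 = t K - d, so the generated algebra is
    {F + G K}.  The discriminant t^2 - 4 d is a polynomial in q1, q2 with value
    b^2 <> 0 at the origin; it is therefore nonzero on a dense open set, where K
    is diagonalizable and, together with the identity, independent. *)

(** * Smooth functions *)

Section RealFunctions.
Variable R : realType.
Implicit Types u v : phase R -> R.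
Local Notation dir := (dir R).

Lemma Ck_cst n (c : R) : Ck n (fun _ : phase R => c).
Proof.
elim: n c => [|n IH] c /=; first exact: cst_continuous.
move=> j; split; first by move=> x; exact: derivable_cst.
rewrite (_ : (fun x => _) = fun=> (0 : R)); first exact: IH.
by apply/funext => x; exact: derive_cst.
Qed.

Lemma is_derive_coord (i : 'I_4) (x w : phase R) :
  is_derive x w (fun y : phase R => y 0 i) (w 0 i).
Proof.
(* For nonzero [h] the difference quotient equals the constant [w 0 i]. *)
have H : (fun h : R => h^-1 *: ((h *: w + x) 0 i - x 0 i)) @ 0^' --> (w 0 i : R).
  apply: (@cvg_trans _ (nbhs (cst (w 0 i : R) @ (0:R)^'))); last exact: cvg_cst.
  apply: near_eq_cvg; near=> h => /=.
  rewrite !mxE addrK; apply/esym; rewrite scalerA mulVf ?scale1r //.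
  near: h; exact: nbhs_dnbhs_neq.
apply: DeriveDef; last exact: cvg_lim.
by apply/cvg_ex; exists (w 0 i).
Unshelve. all: by end_near.
Qed.


Lemma Ck_coord n (i : 'I_4) : Ck n (fun x : phase R => x 0 i).
Proof.
case: n => [|n]; first by move=> x; exact: coord_continuous.
move=> j; split=> [x|]; first by case: (is_derive_coord i x (dir j)).
rewrite (_ : (fun x => _) = fun=> dir j 0 i); first exact: Ck_cst.
by apply/funext => x; case: (is_derive_coord i x (dir j)).
Qed.

Lemma Ck_add n u v : Ck n u -> Ck n v -> Ck n (u + v).
Proof.
elim: n u v => [|n IH] u v; first by move=> cu cv x; exact: (cvgD (cu x) (cv x)).
move=> /= Hu Hv j; have [du Du] := Hu j; have [dv Dv] := Hv j.
split=> [x|]; first exact: derivableD.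
rewrite (_ : (fun x => _) =
  (fun x => 'D_(dir j) u x) + (fun x => 'D_(dir j) v x)); first exact: IH.
by apply/funext => x; rewrite deriveD.
Qed.

Definition Cinf u := forall n, Ck n u.

Lemma CinfD u v : Cinf u -> Cinf v -> Cinf (u + v).
Proof. by move=> Hu Hv n; exact: Ck_add. Qed.

Lemma Cinf_derivable u j x : Cinf u -> derivable u x (dir j).
Proof. by move=> H; have [] := H 1%N j. Qed.

Lemma Cinf_derive u j : Cinf u -> Cinf (fun x => 'D_(dir j) u x).
Proof. by move=> H n; have [] := H n.+1 j. Qed.

(* The induction must range over all pairs of smooth functions: the derivative
   of u * v involves products of other pairs. *)
Lemma CinfM u v : Cinf u -> Cinf v -> Cinf (u * v).
Proof.
move=> + + n; elim: n u v => [|n IH] u v Hu Hv.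
  by move=> x; exact: (cvgM (Hu 0%N x) (Hv 0%N x)).
move=> j; split=> [x|]; first by apply: derivableM; exact: Cinf_derivable.
rewrite (_ : (fun x => _) =
  u * (fun x => 'D_(dir j) v x) + v * (fun x => 'D_(dir j) u x)).
  by apply: Ck_add; apply: IH => //; exact: Cinf_derive.
apply/funext => x; rewrite deriveM; [by []| |]; exact: Cinf_derivable.
Qed.

Lemma CinfN u : Cinf u -> Cinf (- u).
Proof.
move=> Hu; rewrite (_ : - u = (fun=> -1) * u).
  by apply: CinfM => // n; exact: Ck_cst.
by apply/funext => x; rewrite /= mulN1r.
Qed.

End RealFunctions.

(** * Complex-valued functions and the rules for their partial derivatives *)

Section ComplexFunctions.
Variable R : realType.
Implicit Types (F G : cfun R) (c : R[i]).
Local Notation dir := (dir R).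

Lemma smoothP F : smooth F <->
  Cinf R (fun x => complex.Re (F x)) /\ Cinf R (fun x => complex.Im (F x)).
Proof.
by split=> [H | [H1 H2] n]; [split=> n; have [] := H n | split; [exact: H1|exact: H2]].
Qed.

Lemma ReD c d : complex.Re (c + d) = complex.Re c + complex.Re d.
Proof. by case: c d => [? ?] []. Qed.

Lemma ImD c d : complex.Im (c + d) = complex.Im c + complex.Im d.
Proof. by case: c d => [? ?] []. Qed.

Lemma ReM c d : complex.Re (c * d) =
  complex.Re c * complex.Re d - complex.Im c * complex.Im d.
Proof. by case: c d => [? ?] []. Qed.

Lemma ImM c d : complex.Im (c * d) =
  complex.Re c * complex.Im d + complex.Im c * complex.Re d.
Proof. by case: c d => [? ?] []. Qed.

Lemma smooth_cst c : smooth (fun _ : phase R => c).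
Proof. by move=> n; split; exact: Ck_cst. Qed.

Lemma smooth_coord (i : 'I_4) : smooth (fun x : phase R => (x 0 i)%:C%C).
Proof. by move=> n; split; [exact: Ck_coord | exact: Ck_cst]. Qed.

Lemma smoothD F G : smooth F -> smooth G -> smooth (fun x => F x + G x).
Proof.
move=> /smoothP[F1 F2] /smoothP[G1 G2]; apply/smoothP; split.
  under [X in Cinf _ X]eq_fun do rewrite ReD; exact: CinfD.
under [X in Cinf _ X]eq_fun do rewrite ImD; exact: CinfD.
Qed.

Lemma smoothM F G : smooth F -> smooth G -> smooth (fun x => F x * G x).
Proof.
move=> /smoothP[F1 F2] /smoothP[G1 G2]; apply/smoothP; split.
  under [X in Cinf _ X]eq_fun do rewrite ReM.
  by apply: CinfD; [|apply: CinfN]; exact: CinfM.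
under [X in Cinf _ X]eq_fun do rewrite ImM; by apply: CinfD; exact: CinfM.
Qed.

Lemma smooth_sum (I : Type) (r : seq I) (F : I -> cfun R) :
  (forall i, smooth (F i)) -> smooth (fun x => \sum_(i <- r) F i x).
Proof.
move=> H; elim: r => [|i r IH].
  by under [X in smooth X]eq_fun do rewrite big_nil; exact: smooth_cst.
by under [X in smooth X]eq_fun do rewrite big_cons; exact: smoothD.
Qed.

Lemma partial_cst j c x : partial j (fun _ : phase R => c) x = 0.
Proof. by rewrite /partial !derive_cst. Qed.

Lemma partial_coord j (i : 'I_4) (x : phase R) :
  partial j (fun x : phase R => (x 0 i)%:C%C) x = (i == j)%:R.
Proof.
rewrite /partial /= derive_cst.
have [_ ->] := is_derive_coord R i x (dir j).
by rewrite mxE eqxx /=; case: (i == j).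
Qed.

Lemma partialD j F G x : smooth F -> smooth G ->
  partial j (fun y => F y + G y) x = partial j F x + partial j G x.
Proof.
move=> /smoothP[F1 F2] /smoothP[G1 G2]; rewrite /partial.
under [X in 'D__ X _]eq_fun do rewrite ReD.
under [X in (_ +i* 'D__ X _)%C]eq_fun do rewrite ImD.
by rewrite !deriveD //; exact: Cinf_derivable.
Qed.

Lemma partialM j F G x : smooth F -> smooth G ->
  partial j (fun y => F y * G y) x = partial j F x * G x + F x * partial j G x.
Proof.
move=> /smoothP[F1 F2] /smoothP[G1 G2]; rewrite /partial.
under [X in 'D__ X _]eq_fun do rewrite ReM.
under [X in (_ +i* 'D__ X _)%C]eq_fun do rewrite ImM.
have dM (u v : phase R -> R) : Cinf R u -> Cinf R v ->
    'D_(dir j) (u * v) x = u x * 'D_(dir j) v x + v x * 'D_(dir j) u x.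
  by move=> Hu Hv; rewrite deriveM //; exact: Cinf_derivable.
have dMd (u v : phase R -> R) : Cinf R u -> Cinf R v -> derivable (u * v) x (dir j).
  by move=> Hu Hv; apply: derivableM; exact: Cinf_derivable.
rewrite deriveB ?deriveD ?dM //; try exact: dMd.
case: (F x) (G x) => [a b] [c d] /=; apply/eqP; rewrite eq_complex /=.
by apply/andP; split; apply/eqP; ring.
Qed.

Lemma partial_sum (I : Type) (r : seq I) (F : I -> cfun R) j x :
  (forall i, smooth (F i)) ->
  partial j (fun y => \sum_(i <- r) F i y) x = \sum_(i <- r) partial j (F i) x.
Proof.
move=> H; elim: r => [|i r IH].
  under [X in partial _ X _]eq_fun do rewrite big_nil.
  by rewrite partial_cst big_nil.
under [X in partial _ X _]eq_fun do rewrite big_cons.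
by rewrite partialD ?IH ?big_cons //; exact: smooth_sum.
Qed.

End ComplexFunctions.

(** * The torsions as algebraic expressions *)

(* D plays the role of the directional derivative [v |-> D_v L] of the operator
   field whose value is A. *)
Definition torsion {C : comNzRingType} {n} (A : 'M[C]_n)
    (D : 'cV[C]_n -> 'M[C]_n) (u v : 'cV[C]_n) : 'cV[C]_n :=
  D (A *m u) *m v - D (A *m v) *m u - A *m (D u *m v - D v *m u).

Definition htorsion {C : comNzRingType} {n} (A : 'M[C]_n)
    (D : 'cV[C]_n -> 'M[C]_n) (u v : 'cV[C]_n) : 'cV[C]_n :=
  A *m (A *m torsion A D u v) + torsion A D (A *m u) (A *m v)
  - A *m (torsion A D u (A *m v) + torsion A D (A *m u) v).

(* [ring] has no support for modules: the products are made atoms and the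
   identity is checked on the entries. *)
Ltac mxring :=
  repeat match goal with |- context [torsion ?A ?D ?u ?v] =>
    let t := fresh "t" in set t := (torsion A D u v); clearbody t end;
  do 2 rewrite ?(mulmxDl, mulmxDr, mulmxN, mulNmx) -?(scalemxAl, scalemxAr);
  rewrite ?mulmxA;
  repeat match goal with |- context [@mulmx ?S ?m ?n ?p ?A ?B] =>
    let t := fresh "t" in set t := (@mulmx S m n p A B); clearbody t end;
  apply/matrixP => ? ?; rewrite ?mxE; ring.

Section Torsion.
Variables (C : comNzRingType) (n : nat).
Implicit Types (A : 'M[C]_n) (D : 'cV[C]_n -> 'M[C]_n) (u v : 'cV[C]_n).

Lemma torsionD A D D' u v :
  torsion A (fun w => D w + D' w) u v = torsion A D u v + torsion A D' u v.
Proof. by rewrite /torsion; mxring. Qed.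

Lemma htorsionD A D D' u v :
  htorsion A (fun w => D w + D' w) u v = htorsion A D u v + htorsion A D' u v.
Proof. by rewrite /htorsion !(torsionD A D D'); mxring. Qed.

Lemma torsionZ A a D u v : torsion A (fun w => a *: D w) u v = a *: torsion A D u v.
Proof. by rewrite /torsion; mxring. Qed.

Lemma htorsionZ A a D u v : htorsion A (fun w => a *: D w) u v = a *: htorsion A D u v.
Proof. by rewrite /htorsion !(torsionZ A a D); mxring. Qed.

(* Writing A_0, A_1, A_2 for the actions of A on the value, on u and on v, the
   Haantjes torsion is (A_0 - A_1) (A_0 - A_2) applied to the torsion.  On the
   term [phi u *: (B *m v)] one has A_0 = A_2, and on the term with u and v
   exchanged A_0 = A_1. *)
Lemma htorsion_comm A B (phi : 'cV[C]_n -> C) u v : A *m B = B *m A ->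
  htorsion A (fun w => phi w *: B) u v = 0.
Proof.
move=> AB; rewrite /htorsion /torsion.
have E (w : 'cV[C]_n) : B *m (A *m w) = A *m (B *m w) by rewrite !mulmxA AB.
rewrite !(mulmxDl, mulmxDr, mulmxN, mulNmx).
rewrite -!(scalemxAl, scalemxAr) !E.
mxring.
Qed.

(* Only the differences between the actions of A on u, on v and on the values
   enter, so that A may be shifted by a scalar. *)
Lemma torsion_affine A a b (D : {linear 'cV[C]_n -> 'M[C]_n}) u v :
  torsion (a%:M + b *: A) D u v = b *: torsion A D u v.
Proof.
rewrite /torsion !mulmxDl !mul_scalar_mx -!scalemxAl !linearD !linearZ /=.
mxring.
Qed.

Lemma torsion_linl A a b (D : {linear 'cV[C]_n -> 'M[C]_n}) u u' v :
  torsion A D (a *: u + b *: u') v = a *: torsion A D u v + b *: torsion A D u' v.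
Proof.
rewrite /torsion !mulmxDr -!scalemxAr !linearD !linearZ /=; mxring.
Qed.

Lemma torsion_linr A a b (D : {linear 'cV[C]_n -> 'M[C]_n}) u v v' :
  torsion A D u (a *: v + b *: v') = a *: torsion A D u v + b *: torsion A D u v'.
Proof.
rewrite /torsion !mulmxDr -!scalemxAr !linearD !linearZ /=; mxring.
Qed.

(** The inner torsion contributes one factor [b]; each of the two differences of actions of [A]
    applied to it contributes another, and [a] cancels in both. *)
Lemma htorsion_affine A a b (D : {linear 'cV[C]_n -> 'M[C]_n}) u v :
  htorsion (a%:M + b *: A) D u v = b ^+ 3 *: htorsion A D u v.
Proof.
rewrite /htorsion !(torsion_affine A a b D).
rewrite !mulmxDl !mul_scalar_mx -!scalemxAl.
rewrite !(torsion_linl A _ _ D) !(torsion_linr A _ _ D).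
mxring.
Qed.

End Torsion.

(** * Torsions of operator fields on phase space *)

Section Operators.
Variable R : realType.
Implicit Types (X Y : vfield R) (L K : operator R) (F G : cfun R).
Local Notation C := (R[i]).

Definition jac X (x : phase R) : 'M[C]_4 :=
  \matrix_(i, j) partial j (fun y => X y i 0) x.

Definition ddir L (x : phase R) (v : 'cV[C]_4) : 'M[C]_4 :=
  \matrix_(i, k) \sum_j partial j (fun y => L y i k) x * v j 0.

Fact ddir_is_linear L x : linear (ddir L x).
Proof.
move=> a u v; apply/matrixP => i k; rewrite !mxE mulr_sumr -big_split /=.
by apply: eq_bigr => j _; rewrite !mxE; ring.
Qed.

HB.instance Definition _ L x :=
  GRing.isLinear.Build C 'cV[C]_4 'M[C]_4 _ (ddir L x) (ddir_is_linear L x).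

Lemma lie_bracketE X Y x :
  lie_bracket X Y x = jac Y x *m X x - jac X x *m Y x.
Proof.
apply/colP => i; rewrite !mxE -sumrB; apply: eq_bigr => j _; rewrite !mxE; ring.
Qed.

Lemma smooth_app L X : smooth_operator L -> smooth_vfield X -> smooth_vfield (app L X).
Proof.
move=> HL HX i; under [Z in smooth Z]eq_fun do rewrite mxE.
by apply: smooth_sum => j; exact: smoothM.
Qed.

(** Leibniz rule for the components of [L X], contracted with [v]. *)
Lemma jac_app L X x v : smooth_operator L -> smooth_vfield X ->
  jac (app L X) x *m v = ddir L x v *m X x + L x *m (jac X x *m v).
Proof.
move=> HL HX; rewrite mulmxA -[in RHS]mulmxA; apply/colP => i; rewrite !mxE.
transitivity (\sum_j \sum_k (partial j (fun y => L y i k) x * X x k 0 * v j 0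
   + L x i k * partial j (fun y => X y k 0) x * v j 0)).
  apply: eq_bigr => j _; rewrite mxE.
  under [Z in partial _ Z _]eq_fun do rewrite mxE.
  rewrite partial_sum => [|k]; last exact: smoothM.
  rewrite mulr_suml; apply: eq_bigr => k _; rewrite partialM //; ring.
rewrite exchange_big -big_split /=; apply: eq_bigr => k _.
rewrite !mxE big_split /= mulr_suml mulr_sumr; congr (_ + _).
  by apply: eq_bigr => j _; rewrite ?mxE; ring.
by apply: eq_bigr => j _; rewrite ?mxE; ring.
Qed.

(** The terms in [jac X x] and [jac Y x] coming from the Leibniz rule cancel, so only the values of
    [X] and [Y] at [x] remain. *)
Lemma nijenhuisE L X Y x : smooth_operator L -> smooth_vfield X -> smooth_vfield Y ->
  nijenhuis L X Y x = torsion (L x) (ddir L x) (X x) (Y x).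
Proof.
move=> HL HX HY.
have E Z W : lie_bracket Z W x = jac W x *m Z x - jac Z x *m W x.
  exact: lie_bracketE.
have EX v : jac (app L X) x *m v = ddir L x v *m X x + L x *m (jac X x *m v).
  exact: jac_app.
have EY v : jac (app L Y) x *m v = ddir L x v *m Y x + L x *m (jac Y x *m v).
  exact: jac_app.
transitivity (L x *m (L x *m lie_bracket X Y x) + lie_bracket (app L X) (app L Y) x
  - L x *m (lie_bracket X (app L Y) x + lie_bracket (app L X) Y x)); first by [].
rewrite (E X Y) (E (app L X) Y) (E X (app L Y)) (E (app L X) (app L Y)) EX EX EY EY.
rewrite /torsion -[app L X x]/(L x *m X x) -[app L Y x]/(L x *m Y x).
mxring.
Qed.

(** The Haantjes torsion never differentiates the Nijenhuis torsion, so the pointwise formula for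
    the latter, used also at [L X] and [L Y], suffices. *)
Lemma haantjesE L X Y x : smooth_operator L -> smooth_vfield X -> smooth_vfield Y ->
  haantjes L X Y x = htorsion (L x) (ddir L x) (X x) (Y x).
Proof.
move=> HL HX HY; rewrite /haantjes /htorsion /app.
by rewrite !nijenhuisE //; exact: smooth_app.
Qed.

Lemma haantjes_operatorP L : smooth_operator L ->
  (forall x u v, htorsion (L x) (ddir L x) u v = 0) -> haantjes_operator L.
Proof. by move=> HL H; split=> // X Y HX HY x; rewrite haantjesE. Qed.

Definition span1 F G K : operator R := fun x => (F x)%:M + G x *: K x.

Lemma smooth_span1 F G K : smooth F -> smooth G -> smooth_operator K ->
  smooth_operator (span1 F G K).
Proof.
move=> HF HG HK i j; under [Z in smooth Z]eq_fun do rewrite !mxE mulrb.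
apply: smoothD; last exact: smoothM.
by case: (i == j) => //; exact: smooth_cst.
Qed.

Lemma ddir_span1 F G K x v : smooth F -> smooth G -> smooth_operator K ->
  ddir (span1 F G K) x v =
   (\sum_j partial j F x * v j 0)%:M + (\sum_j partial j G x * v j 0) *: K x
     + G x *: ddir K x v.
Proof.
move=> HF HG HK; apply/matrixP => i k; rewrite !mxE.
rewrite mulr_suml mulr_sumr -sumrMnl -!big_split /=; apply: eq_bigr => j _.
under [Z in partial _ Z _]eq_fun do rewrite !mxE mulrb.
rewrite partialD ?partialM //; first last.
- exact: smoothM.
- by case: (i == k) => //; exact: smooth_cst.
by case: (i == k); rewrite ?partial_cst /= ?mulr1n ?mulr0n; ring.
Qed.

(** The derivative of [F + G K] has three terms. Those along the identity and along [K] are killed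
    by [htorsion_comm]; the term [G] times the derivative of [K] gives [G ^+ 4] times the torsion of
    [K]. *)
Lemma haantjes_span1 F G K : smooth F -> smooth G -> smooth_operator K ->
  (forall x u v, htorsion (K x) (ddir K x) u v = 0) ->
  haantjes_operator (span1 F G K).
Proof.
move=> HF HG HK H; apply: haantjes_operatorP; first exact: smooth_span1.
move=> x u v.
have -> : ddir (span1 F G K) x = fun w =>
    (\sum_j partial j F x * w j 0) *: 1%:M
    + (\sum_j partial j G x * w j 0) *: K x + G x *: ddir K x w.
  by apply/funext => w; rewrite ddir_span1 // scalemx1.
rewrite 2!htorsionD htorsionZ htorsion_affine H !htorsion_comm ?addr0 ?scaler0 //.
- by rewrite addr0.
- by rewrite /span1 mulmxDl mulmxDr -scalemxAl -scalemxAr scalar_mxC.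
- by rewrite mulmx1 mul1mx.
Qed.

End Operators.

(** * The operator Ke in coordinates *)

Section Explicit.
Variable R : realType.
Local Notation C := (R[i]).

Definition col4 (a b c d : C) : 'cV[C]_4 := \col_i nth 0 [:: a; b; c; d] i.

Lemma ord4_ind (P : 'I_4 -> Prop) : P 0 -> P 1 -> P 2 -> P 3 -> forall i, P i.
Proof.
move=> P0 P1 P2 P3 [[|[|[|[|//]]]] lti].
- by rewrite (_ : Ordinal lti = 0) //; apply: val_inj.
- by rewrite (_ : Ordinal lti = 1) //; apply: val_inj.
- by rewrite (_ : Ordinal lti = 2) //; apply: val_inj.
- by rewrite (_ : Ordinal lti = 3) //; apply: val_inj.
Qed.

Lemma big_ord4 (F : 'I_4 -> C) : \sum_i F i = F 0 + F 1 + F 2 + F 3.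
Proof.
rewrite !big_ord_recr big_ord0 /= add0r.
by congr (F _ + F _ + F _ + F _); exact: val_inj.
Qed.

Lemma col4E (v : 'cV[C]_4) : v = col4 (v 0 0) (v 1 0) (v 2 0) (v 3 0).
Proof. by apply/colP; apply: ord4_ind; rewrite mxE. Qed.

Lemma mul_mx_of_rows (a00 a01 a02 a03 a10 a11 a12 a13 a20 a21 a22 a23
    a30 a31 a32 a33 x y z t : C) :
  mx_of_rows [:: [:: a00; a01; a02; a03]; [:: a10; a11; a12; a13];
                 [:: a20; a21; a22; a23]; [:: a30; a31; a32; a33]] *m col4 x y z t
  = col4 (a00 * x + a01 * y + a02 * z + a03 * t)
         (a10 * x + a11 * y + a12 * z + a13 * t)
         (a20 * x + a21 * y + a22 * z + a23 * t)
         (a30 * x + a31 * y + a32 * z + a33 * t).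
Proof. by apply/colP; apply: ord4_ind; rewrite !mxE big_ord4 !mxE. Qed.

Lemma col4D a b c d a' b' c' d' : col4 a b c d + col4 a' b' c' d' =
  col4 (a + a') (b + b') (c + c') (d + d').
Proof. by apply/colP; apply: ord4_ind; rewrite !mxE. Qed.

Lemma col4N a b c d : - col4 a b c d = col4 (- a) (- b) (- c) (- d).
Proof. by apply/colP; apply: ord4_ind; rewrite !mxE. Qed.

(** The matrix of [Ke] at a point, for [a = - g2 * k1 ^+ 2], [b = - k2 ^+ 2] and [c = a + b * g2];
    here the three coefficients are independent. *)
Definition Kmx (a b c q1 q2 p1 p2 : C) : 'M[C]_4 := mx_of_rows
  [:: [:: a * q2 ^+ 2; - a * q1 * q2; 0; 0];
      [:: - c * q1 * q2; c * q1 ^+ 2 + b; 0; 0];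
      [:: 0; a * q2 * p1 - c * q1 * p2; a * q2 ^+ 2; - c * q1 * q2];
      [:: c * q1 * p2 - a * q2 * p1; 0; - a * q1 * q2; c * q1 ^+ 2 + b]].

(** [dw] is the derivative of [c * q1 * p2 - a * q2 * p1] and [dm] that of [q1 * q2]. *)
Definition dKrows (a b c q1 q2 p1 p2 v0 v1 v2 v3 : C) : 'M[C]_4 :=
  let dw := c * (v0 * p2 + q1 * v3) - a * (v1 * p1 + q2 * v2) in
  let dm := v0 * q2 + q1 * v1 in
  mx_of_rows
  [:: [:: a * (2 * q2 * v1); - a * dm; 0; 0];
      [:: - c * dm; c * (2 * q1 * v0); 0; 0];
      [:: 0; - dw; a * (2 * q2 * v1); - c * dm];
      [:: dw; 0; - a * dm; c * (2 * q1 * v0)]].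

(* The derivative of Kmx in the direction v. *)
Definition dKmx (a b c q1 q2 p1 p2 : C) (v : 'cV[C]_4) : 'M[C]_4 :=
  dKrows a b c q1 q2 p1 p2 (v 0 0) (v 1 0) (v 2 0) (v 3 0).

Lemma dKmxE a b c q1 q2 p1 p2 v0 v1 v2 v3 :
  dKmx a b c q1 q2 p1 p2 (col4 v0 v1 v2 v3)
  = dKrows a b c q1 q2 p1 p2 v0 v1 v2 v3.
Proof. by rewrite /dKmx !mxE. Qed.

Lemma htorsion_Kmx a b c q1 q2 p1 p2 u v :
  htorsion (Kmx a b c q1 q2 p1 p2) (dKmx a b c q1 q2 p1 p2) u v = 0.
Proof.
rewrite (col4E u) (col4E v).
move: (u 0 0) (u 1 0) (u 2 0) (u 3 0) (v 0 0) (v 1 0) (v 2 0) (v 3 0).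
move=> u0 u1 u2 u3 v0 v1 v2 v3.
set D := dKmx a b c q1 q2 p1 p2; set K := Kmx a b c q1 q2 p1 p2.
(* The actions on columns are put in factored form. Once [K] and [D] are opaque, the torsion is
   computed by nesting these actions, without expanding matrix products. *)
have EK x y z t : K *m col4 x y z t =
    col4 (q2 * a * (q2 * x - q1 * y)) (c * q1 * (q1 * y - q2 * x) + b * y)
      ((a * q2 * p1 - c * q1 * p2) * y + q2 * (a * q2 * z - c * q1 * t))
      ((c * q1 * p2 - a * q2 * p1) * x + q1 * (c * q1 * t - a * q2 * z) + b * t).
  by rewrite mul_mx_of_rows; congr col4; ring.
have ED x0 x1 x2 x3 y0 y1 y2 y3 : D (col4 x0 x1 x2 x3) *m col4 y0 y1 y2 y3 =
   let dw := c * (x0 * p2 + q1 * x3) - a * (x1 * p1 + q2 * x2) in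
   let dm := x0 * q2 + q1 * x1 in
   col4 (a * (2 * q2 * x1 * y0 - dm * y1)) (c * (2 * q1 * x0 * y1 - dm * y0))
     (a * 2 * q2 * x1 * y2 - c * dm * y3 - dw * y1)
     (c * 2 * q1 * x0 * y3 - a * dm * y2 + dw * y0).
  by rewrite /D dKmxE /dKrows mul_mx_of_rows; congr col4; ring.
clearbody K D.
rewrite /htorsion /torsion !(EK, ED, col4D, col4N) /=.
rewrite -[RHS](_ : col4 0 0 0 0 = 0); last by apply/colP; apply: ord4_ind; rewrite !mxE.
by congr col4; ring.
Qed.

End Explicit.

(** * Differentials computed from the shape of a function *)

Section Derivations.
Variable R : realType.
Implicit Types (F G : cfun R) (x : phase R) (v : 'cV[R[i]]_4).

(** Smoothness and differential are bundled so that a single recursion over the expression of [F]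
    yields both. *)
Definition is_der F (dF : phase R -> 'cV[R[i]]_4 -> R[i]) :=
  smooth F /\ forall x v, \sum_j partial j F x * v j 0 = dF x v.

Lemma is_der_cst c : is_der (fun=> c) (fun _ _ => 0).
Proof.
split=> [|x v]; first exact: smooth_cst.
by apply: big1 => j _; rewrite partial_cst mul0r.
Qed.

Lemma is_der_coord (i : 'I_4) : is_der (fun x => (x 0 i)%:C%C) (fun _ v => v i 0).
Proof.
split=> [|x v]; first exact: smooth_coord.
rewrite (bigD1 i) //= partial_coord eqxx mul1r big1 ?addr0 // => j ji.
by rewrite partial_coord eq_sym (negPf ji) mul0r.
Qed.

Lemma is_derD F G dF dG : is_der F dF -> is_der G dG ->
  is_der (fun x => F x + G x) (fun x v => dF x v + dG x v).
Proof.
move=> [sF HF] [sG HG]; split=> [|x v]; first exact: smoothD.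
rewrite -HF -HG -big_split; apply: eq_bigr => j _.
by rewrite partialD // mulrDl.
Qed.

Lemma is_derM F G dF dG : is_der F dF -> is_der G dG ->
  is_der (fun x => F x * G x) (fun x v => dF x v * G x + F x * dG x v).
Proof.
move=> [sF HF] [sG HG]; split=> [|x v]; first exact: smoothM.
rewrite -HF -HG mulr_suml mulr_sumr -big_split; apply: eq_bigr => j _.
by rewrite partialM //=; ring.
Qed.

Lemma is_derN F dF : is_der F dF -> is_der (fun x => - F x) (fun x v => - dF x v).
Proof.
move=> HF; have [+ E] := is_derM _ _ _ _ (is_der_cst (- 1)) HF.
under [X in smooth X]eq_fun do rewrite mulN1r.
split=> // x v; rewrite -[RHS]mulN1r -[RHS]add0r -[X in X + _](mul0r (F x)) -E.
by under [in RHS]eq_bigr do under [Z in partial _ Z _]eq_fun do rewrite mulN1r.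
Qed.

Lemma is_der_sqr F dF : is_der F dF ->
  is_der (fun x => F x ^+ 2) (fun x v => 2 * F x * dF x v).
Proof.
move=> HF; have [sFF E] := is_derM _ _ _ _ HF HF.
split=> [//|x v]; rewrite [LHS]E; ring.
Qed.

End Derivations.

(* The head symbol selects the rule: [apply] alone would try to unfold the
   operations of R[i]. *)
Ltac solve_is_der :=
  lazymatch goal with
  | |- is_der _ (fun x => GRing.add (@?F x) (@?G x)) _ =>
      refine (is_derD _ F G _ _ _ _); solve_is_der
  | |- is_der _ (fun x => GRing.opp (@?F x)) _ => refine (is_derN _ F _ _); solve_is_der
  | |- is_der _ (fun x => GRing.mul (@?F x) (@?G x)) _ =>
      refine (is_derM _ F G _ _ _ _); solve_is_der
  | |- is_der _ (fun x => GRing.exp (@?F x) 2) _ =>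
      refine (is_der_sqr _ F _ _); solve_is_der
  | |- is_der _ (fun x => q1 x) _ => exact (is_der_coord _ 0)
  | |- is_der _ (fun x => q2 x) _ => exact (is_der_coord _ 1)
  | |- is_der _ (fun x => p1 x) _ => exact (is_der_coord _ 2)
  | |- is_der _ (fun x => p2 x) _ => exact (is_der_coord _ 3)
  | |- is_der _ (fun _ => ?c) _ => exact (is_der_cst _ c)
  end.

(** * Properties of [Ke] and of the algebra it generates with the identity *)

Section KeOperator.
Variables (R : realType) (g1 g2 : R[i]) (f : R).
Implicit Types (x : phase R) (u v : 'cV[R[i]]_4).

Let a : R[i] := - g2 * k1 f ^+ 2.
Let b : R[i] := - k2 f ^+ 2.
Let c : R[i] := a + b * g2.

Lemma KeE x : Ke g2 f x = Kmx _ a b c (q1 x) (q2 x) (p1 x) (p2 x).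
Proof.
apply/matrixP; apply: ord4_ind; apply: ord4_ind; rewrite !mxE /= /c /b /a /J; ring.
Qed.

(** The differentiation rules build an unsimplified [dF] for each entry, which [ring] then
    identifies with the entry of [dKmx]. *)
Lemma Ke_entry i j : exists dF, is_der R (fun x => Ke g2 f x i j) dF /\ forall x v,
  dF x v = dKmx _ a b c (q1 x) (q2 x) (p1 x) (p2 x) v i j.
Proof.
have -> : (fun x => Ke g2 f x i j) = fun x => nth 0 (nth [::]
  [:: [:: a * q2 x ^+ 2; - a * q1 x * q2 x; 0; 0];
      [:: - c * q1 x * q2 x; c * q1 x ^+ 2 + b; 0; 0];
      [:: 0; a * q2 x * p1 x - c * q1 x * p2 x; a * q2 x ^+ 2; - c * q1 x * q2 x];
      [:: c * q1 x * p2 x - a * q2 x * p1 x; 0; - a * q1 x * q2 x;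
          c * q1 x ^+ 2 + b]] i) j.
  by apply/funext => x; rewrite KeE mxE.
move: i j; apply: ord4_ind; apply: ord4_ind => /=; (eexists; split; [solve_is_der|]).
all: move=> x v; rewrite /dKmx /dKrows mxE /q1 /q2 /p1 /p2 /=; ring.
Qed.

Lemma smooth_Ke : smooth_operator (Ke g2 f).
Proof. by move=> i j; have [dF [[]]] := Ke_entry i j. Qed.

Lemma ddir_Ke x : ddir _ (Ke g2 f) x = dKmx _ a b c (q1 x) (q2 x) (p1 x) (p2 x).
Proof.
apply/funext => v; apply/matrixP => i j; rewrite mxE.
by have [dF [[_ ->] ->]] := Ke_entry i j.
Qed.

Lemma htorsion_Ke x u v : htorsion (Ke g2 f x) (ddir _ (Ke g2 f) x) u v = 0.
Proof. by rewrite ddir_Ke KeE htorsion_Kmx. Qed.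

Lemma differentialE F dF x i : is_der R F dF ->
  differential F x i 0 = dF x (delta_mx i 0).
Proof.
move=> [_ <-]; rewrite mxE (bigD1 i) //= mxE !eqxx mulr1 big1 ?addr0 // => j ji.
by rewrite mxE (negPf ji) mulr0.
Qed.

(** With [w = q1 p1 + q2 p2], the factor [S] is the derivative of [g1 w + g2 w^2] in [w], and the
    differential is [S dw + 2 p1 dp1 + 2 p2 dp2]. *)
Lemma differential_H2 x : differential (H2 g1 g2) x =
  let S := g1 + 2 * g2 * (q1 x * p1 x + q2 x * p2 x) in
  col4 _ (S * p1 x) (S * p2 x) (2 * p1 x + S * q1 x) (2 * p2 x + S * q2 x).
Proof.
have [dH [HH EH]] : exists dH, is_der R (H2 g1 g2) dH /\ forall y v, dH y v =
    let S := g1 + 2 * g2 * (q1 y * p1 y + q2 y * p2 y) in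
    S * (p1 y * v 0 0 + p2 y * v 1 0 + q1 y * v 2 0 + q2 y * v 3 0)
    + 2 * (p1 y * v 2 0 + p2 y * v 3 0).
  rewrite /H2; eexists; split; first solve_is_der.
  by move=> y v; rewrite /q1 /q2 /p1 /p2 /=; ring.
apply/colP => i; rewrite (differentialE _ _ _ _ HH) EH /=.
by move: i; apply: ord4_ind; rewrite !mxE /=; ring.
Qed.

(** This is [2 a J dJ + b dI2], since [Ie = a J^2 + b I2]. *)
Lemma differential_Ie x : differential (Ie g1 g2 f) x =
  col4 _ (2 * a * J x * p2 x + 2 * b * g2 * q1 x * p2 x ^+ 2)
    (- (2 * a * J x * p1 x) + b * (2 * g2 * q2 x * p2 x ^+ 2 + g1 * p2 x))
    (- (2 * a * J x * q2 x))
    (2 * a * J x * q1 x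
      + b * (2 * (1 + g2 * (q1 x ^+ 2 + q2 x ^+ 2)) * p2 x + g1 * q2 x)).
Proof.
have [dI [HI EI]] : exists dI, is_der R (Ie g1 g2 f) dI /\ forall y v, dI y v =
    2 * a * J y * (p2 y * v 0 0 - p1 y * v 1 0 - q2 y * v 2 0 + q1 y * v 3 0)
    + b * (2 * g2 * p2 y ^+ 2 * (q1 y * v 0 0 + q2 y * v 1 0) + g1 * p2 y * v 1 0
      + (2 * (1 + g2 * (q1 y ^+ 2 + q2 y ^+ 2)) * p2 y + g1 * q2 y) * v 3 0).
  rewrite /Ie /I2 /J; eexists; split; first solve_is_der.
  by move=> y v; rewrite /a /b /q1 /q2 /p1 /p2 /=; ring.
apply/colP => i; rewrite (differentialE _ _ _ _ HI) EI /=.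
by move: i; apply: ord4_ind; rewrite !mxE /=; ring.
Qed.

(** Each component is a polynomial identity resting on the relation [c = a + b * g2], which is why
    [c] is unfolded. *)
Lemma chain_Ke : chain_equation (Ke g2 f) (H2 g1 g2) (Ie g1 g2 f).
Proof.
move=> x; rewrite differential_H2 differential_Ie KeE.
by apply/colP; apply: ord4_ind; rewrite mxE big_ord4 !mxE /= /J /c; ring.
Qed.

Lemma OmegaE : Omega R = mx_of_rows
  [:: [:: 0; 0; -1; 0]; [:: 0; 0; 0; -1]; [:: 1; 0; 0; 0]; [:: 0; 1; 0; 0]].
Proof.
apply/matrixP; apply: ord4_ind; apply: ord4_ind; rewrite !mxE /omega !mxE /=; ring.
Qed.

Lemma omega_compatible_Ke : omega_compatible (Ke g2 f).
Proof.
move=> x; rewrite OmegaE KeE; apply/matrixP.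
by apply: ord4_ind; apply: ord4_ind; rewrite !mxE !big_ord4 !mxE /=; ring.
Qed.

(* The trace and determinant of the upper left block of Ke, whose
   characteristic polynomial annihilates Ke. *)
Definition Ktr x := a * q2 x ^+ 2 + c * q1 x ^+ 2 + b.

Definition Kdet x := a * b * q2 x ^+ 2.

(** In 2 by 2 blocks, [Ke] is lower triangular with diagonal blocks [N] and its transpose [N^T], to
    which Cayley-Hamilton applies. The lower left block [W] is antisymmetric, whence
    [W N + N^T W = tr(N) W]. *)
Lemma Ke_sqr x : Ke g2 f x *m Ke g2 f x = (- Kdet x)%:M + Ktr x *: Ke g2 f x.
Proof.
rewrite KeE; apply/matrixP.
by apply: ord4_ind; apply: ord4_ind; rewrite !mxE !big_ord4 !mxE /= /Ktr /Kdet; ring.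
Qed.

Lemma smooth_Ktr : smooth Ktr.
Proof.
by have [dF []] : exists dF, is_der R Ktr dF by eexists; rewrite /Ktr; solve_is_der.
Qed.

Lemma smooth_oppKdet : smooth (fun x => - Kdet x).
Proof.
have [dF []] : exists dF, is_der R (fun x => - Kdet x) dF => //.
by eexists; rewrite /Kdet; solve_is_der.
Qed.

Let A := gen_algebra (range (generators g2 f)).

Lemma gen_lincomb : lincomb_closed A.
Proof.
move=> F G K L sF sG AK AL B lB cB sB.
exact: (lB _ _ _ _ sF sG (AK B lB cB sB) (AL B lB cB sB)).
Qed.

Lemma gen_comp : comp_closed A.
Proof.
move=> K L AK AL B lB cB sB; exact: (cB _ _ (AK B lB cB sB) (AL B lB cB sB)).
Qed.

Lemma gen_generators i : A (generators g2 f i).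
Proof. by move=> B _ _; apply; exists i. Qed.

(** The generated algebra is the least closed set containing the generators, so it is enough that
    the operators [F + G K] form such a set; closure under composition comes from [Ke_sqr]. *)
Lemma gen_algebraP K : A K ->
  exists F G, [/\ smooth F, smooth G & K = span1 _ F G (Ke g2 f)].
Proof.
move=> /(_ [set L | exists F G,
  [/\ smooth F, smooth G & L = span1 _ F G (Ke g2 f)]]).
apply.
- move=> F G K1 K2 sF sG [F1 [G1 [sF1 sG1 ->]]] [F2 [G2 [sF2 sG2 ->]]].
  exists (fun x => F x * F1 x + G x * F2 x), (fun x => F x * G1 x + G x * G2 x).
  split; [by apply: smoothD; exact: smoothM|by apply: smoothD; exact: smoothM|].
  apply/funext => x; apply/matrixP => i j; rewrite !mxE.
  by case: (i == j); rewrite ?mulr1n ?mulr0n; ring.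
- move=> K1 K2 [F1 [G1 [sF1 sG1 ->]]] [F2 [G2 [sF2 sG2 ->]]].
  (* Coefficients of [(F1 + G1 K) (F2 + G2 K)] after replacing [K^2] by [t K - d]. *)
  exists (fun x => F1 x * F2 x + (G1 x * G2 x) * - Kdet x),
    (fun x => F1 x * G2 x + (G1 x * F2 x + (G1 x * G2 x) * Ktr x)).
  have sKd := smooth_oppKdet; have sKt := smooth_Ktr.
  have sGG := smoothM _ _ _ sG1 sG2.
  split.
  - exact: smoothD _ _ _ (smoothM _ _ _ sF1 sF2) (smoothM _ _ _ sGG sKd).
  - exact: smoothD _ _ _ (smoothM _ _ _ sF1 sG2)
      (smoothD _ _ _ (smoothM _ _ _ sG1 sF2) (smoothM _ _ _ sGG sKt)).
  apply/funext => x; rewrite /span1.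
  have MM := Ke_sqr x; move: (Ke g2 f x) MM => M MM.
  rewrite !(mulmxDl, mulmxDr) -!scalemxAl -!scalemxAr MM.
  rewrite -scalar_mxM mul_scalar_mx mul_mx_scalar.
  by apply/matrixP => i j; rewrite !mxE; case: (i == j); rewrite ?mulr1n ?mulr0n; ring.
- move=> _ [i _ <-]; rewrite /generators; case: ifP => _.
    exists (fun=> 1), (fun=> 0); split; [exact: smooth_cst|exact: smooth_cst|].
    by apply/funext => x; rewrite /span1 scale0r addr0.
  exists (fun=> 0), (fun=> 1); split; [exact: smooth_cst|exact: smooth_cst|].
  by apply/funext => x; rewrite /span1 scale1r raddf0 add0r.
Qed.

Lemma gen_haantjes K : A K -> haantjes_operator K.
Proof.
move=> /gen_algebraP[F [G [sF sG ->]]].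
apply: haantjes_span1 => //; first exact: smooth_Ke.
exact: htorsion_Ke.
Qed.

Lemma gen_abelian : abelian_algebra A.
Proof.
move=> K L /gen_algebraP[F [G [_ _ ->]]] /gen_algebraP[F' [G' [_ _ ->]]] x.
rewrite /span1; move: (Ke g2 f x) => M.
rewrite !mulmxDl !mulmxDr -!scalemxAl -!scalemxAr -!scalar_mxM.
rewrite !mul_scalar_mx !mul_mx_scalar.
move: (M *m M) => N.
by apply/matrixP => i j; rewrite !mxE; case: (i == j); rewrite ?mulr1n ?mulr0n; ring.
Qed.

Lemma gen_omega K : A K -> omega_compatible K.
Proof.
move=> /gen_algebraP[F [G [_ _ ->]]] x.
have MM := omega_compatible_Ke x; rewrite /span1; move: (Ke g2 f x) MM => M MM.
have -> : ((F x)%:M + G x *: M)^T = (F x)%:M + G x *: M^T.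
  by rewrite linearD linearZ /= tr_scalar_mx.
by rewrite mulmxDr mulmxDl -scalemxAr -scalemxAl MM scalar_mxC.
Qed.

End KeOperator.

(** * Semisimplicity *)

Section Diagonalizable.
Variable F : fieldType.

Lemma mxrank_diag n (e : 'rV[F]_n) : \rank (diag_mx e) = (\sum_i (e 0%R i != 0%R))%N.
Proof.
elim: n e => [|n IH] e.
  by rewrite big_ord0; apply/eqP; rewrite -leqn0 rank_leq_row.
have -> : \rank (diag_mx e) =
    \rank (diag_mx (row_mx (@lsubmx _ 1 1 n e) (@rsubmx _ 1 1 n e))).
  by rewrite (@hsubmxK _ 1 1 n).
rewrite diag_mx_row rank_diag_block_mx IH.
rewrite big_ord_recl /=; congr (_ + _)%N.
  rewrite rank_rV; congr nat_of_bool.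
  have e0 : (@lsubmx _ 1 1 n e) 0 0 = e 0 ord0.
    by rewrite mxE; congr (e _ _); exact: val_inj.
  congr negb; apply/eqP/eqP => [/matrixP/(_ 0 0)|E].
    by rewrite !(mxE, eqxx) mulr1n -e0 mxE.
  by apply/matrixP => i j; rewrite !ord1 [LHS]mxE e0 E !mxE mul0rn.
apply: eq_bigr => i _; rewrite mxE; congr ((e _ _ != _) : nat); exact: val_inj.
Qed.

Lemma char_poly_diag_conj n (P : 'M[F]_n) (d : 'rV[F]_n) : P \in unitmx ->
  char_poly (invmx P *m diag_mx d *m P) = \prod_i ('X - (d 0 i)%:P).
Proof.
move=> uP; rewrite -[RHS](_ : char_poly (diag_mx d) = _); last first.
  rewrite char_poly_trig ?diag_mx_is_trig //; apply: eq_bigr => i _.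
  by rewrite mxE eqxx.
set Q := map_mx polyC P; set Q' := map_mx polyC (invmx P).
have QQ : Q' *m Q = 1%:M by rewrite -map_mxM mulVmx // map_scalar_mx.
rewrite /char_poly /char_poly_mx.
rewrite (_ : 'X%:M - _ = Q' *m ('X%:M - map_mx polyC (diag_mx d)) *m Q); last first.
  rewrite mulmxBr mulmxBl !map_mxM; congr (_ - _).
  by rewrite scalar_mxC -mulmxA QQ mulmx1.
by rewrite !det_mulmx mulrAC -det_mulmx QQ det1 mul1r.
Qed.

(** Both multiplicities count the indices [i] with [d 0 i = l]. *)
Lemma mup_char_poly_diag_conj n (P : 'M[F]_n) (d : 'rV[F]_n) (l : F) : P \in unitmx ->
  let M := invmx P *m diag_mx d *m P in
  mup l (char_poly M) = \rank (eigenspace M^T l).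
Proof.
move=> uP M; rewrite char_poly_diag_conj // mxrank_ker.
have -> : M^T - l%:M = (invmx P *m diag_mx (d - const_mx l) *m P)^T.
  rewrite -[l%:M]tr_scalar_mx -linearB /=; congr trmx.
  rewrite raddfB /= diag_const_mx mulmxBr mulmxBl; congr (_ - _).
  by rewrite scalar_mxC -mulmxA mulVmx // mulmx1.
rewrite mxrank_tr mxrankMfree ?row_free_unit //.
rewrite (eqmxMfull _ _) ?row_full_unit ?unitmx_inv // mxrank_diag.
rewrite (_ : \prod_i _ =
  \prod_(y <- [seq d 0 i | i <- enum 'I_n]) ('X - y%:P)); last first.
  by rewrite big_map big_enum.
rewrite mu_prod_XsubC -sum1_count big_map big_enum_cond /=.
have cn : n = (\sum_(i < n) 1)%N by rewrite sum1_card card_ord.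
rewrite [X in (X - _)%N]cn.
(* Adding the number of indices with [d 0 i != l] removes the truncated subtraction and leaves a
   termwise comparison. *)
apply/eqP; rewrite -(eqn_add2r (\sum_i ((d - const_mx l)%R 0%R i != 0%R))).
rewrite subnK; last first.
  by apply: leq_sum => i _; exact: leq_b1.
rewrite big_mkcond /= -big_split /=; apply/eqP; apply: eq_bigr => i _.
by rewrite !mxE subr_eq0; case: eqP.
Qed.

(** The minimal polynomial divides [(X - r) (X - s)], whose roots are simple. *)
Lemma diagonalizable_quadratic n (M : 'M[F]_n.+1) (r s : F) : r != s ->
  (M - r%:M) *m (M - s%:M) = 0 ->
  exists P d, P \in unitmx /\ M = invmx P *m diag_mx d *m P.
Proof.
move=> rs MM.
have /diagonalizableP[P uP /diagonalizable_forPex[d]] :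
    exists2 q, uniq q & mxminpoly M %| \prod_(x <- q) ('X - x%:P).
  exists [:: r; s]; first by rewrite /= inE rs.
  rewrite big_cons big_seq1; apply: mxminpoly_min.
  by rewrite rmorphM !rmorphB /= !horner_mx_X !horner_mx_C.
by move=> /(simmxLR uP) E; exists P, d; rewrite E mxpoly.conjVmx.
Qed.

End Diagonalizable.

(** * Nonvanishing sets of functions: openness and density *)

Section Density.
Variable R : realType.
Implicit Types (F : cfun R) (x : phase R).

Lemma open_smooth_neq0 F : smooth F -> open [set x | F x != 0].
Proof.
move=> /smoothP[F1 F2].
have -> : [set x | F x != 0] =
    (fun x => complex.Re (F x)) @^-1` [set y | y != 0]
    `|` (fun x => complex.Im (F x)) @^-1` [set y | y != 0].
  apply/seteqP; split=> x /=; rewrite eq_complex negb_and.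
    by case/orP; [left|right].
  by case=> ->; rewrite ?orbT.
have o0 : open [set y : R | y != 0] by exact: open_neq.
apply: openU; (apply: open_comp; last exact: o0).
- by move=> x _; exact: (F1 0%N).
- by move=> x _; exact: (F2 0%N).
Qed.

Lemma polyC_real_neq0 (p : {poly R[i]}) (e : R) : p != 0 -> 0 < e ->
  exists2 s : R, `|s - 1| < e & p.[s%:C%C] != 0.
Proof.
move=> p0 e0; apply: contrapT => H.
(* Since [k.+2 > 1], these distinct points all lie within [e] of 1; [size p] of them are more than a
   nonzero [p] can have as roots. *)
pose s (k : nat) := 1 + e / k.+2%:R.
pose rs := [seq (s k)%:C%C | k <- iota 0 (size p)].
have urs : uniq rs.
  rewrite map_inj_uniq ?iota_uniq // => i j /complexI /addrI.
  move=> /(mulfI (lt0r_neq0 e0)) /invr_inj /eqP.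
  by rewrite eqr_nat => /eqP [].
have ars : all (root p) rs.
  apply/allP => _ /mapP[k _ ->]; rewrite /root; apply: contrapT => /negP pk.
  apply: H; exists (s k) => //; rewrite /s addrAC subrr add0r normrM normfV.
  rewrite !gtr0_norm // ltr_pdivrMr // -[ltLHS]mulr1 ltr_pM2l //.
  by rewrite ltr1n.
by have := max_poly_roots p0 ars urs; rewrite size_map size_iota ltnn.
Qed.

(** Every neighbourhood of [x] contains [s *: x] for [s] close to 1, and on this line [F] is a
    nonzero polynomial in [s]. *)
Lemma dense_ray_poly F :
  (forall x, exists2 p : {poly R[i]}, p != 0 & forall s : R, F (s *: x) = p.[s%:C%C]) ->
  dense [set x | F x != 0].
Proof.
move=> H O [x Ox] oO.
have [p p0 Fp] := H x.
have : nbhs (1 : R) ((fun s : R => s *: x) @^-1` O).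
  have c : {for (1 : R), continuous (fun s : R => s *: x)} by exact: scalel_continuous.
  by apply: c; rewrite scale1r; exact: open_nbhs_nbhs.
move=> /nbhs_ballP[e /= e0 He].
have [s s1 ps] := polyC_real_neq0 p e p0 e0.
exists (s *: x); split; last by rewrite /= Fp.
by apply: He; rewrite /ball /= distrC.
Qed.

Lemma smooth_dense_eq0 F (U : set (phase R)) : smooth F -> dense U ->
  (forall x, U x -> F x = 0) -> forall x, F x = 0.
Proof.
move=> sF dU H x; apply/eqP; apply: contrapT => /negP Fx.
have [y [/= Fy Uy]] := dU [set x | F x != 0] (ex_intro _ x Fx) (open_smooth_neq0 _ sF).
by move: Fy; rewrite H ?eqxx.
Qed.

End Density.

(** * The discriminant of [Ke], independence and generic diagonalizability *)

Section Discriminant.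
Variables (R : realType) (g2 : R[i]) (f : R).
Hypothesis hf0 : 0 < f.
Hypothesis hf1 : f < pi / 2.

Let a : R[i] := - g2 * k1 f ^+ 2.
Let b : R[i] := - k2 f ^+ 2.
Let c : R[i] := a + b * g2.

Definition Kdisc (x : phase R) := Ktr R g2 f x ^+ 2 - 4 * Kdet R g2 f x.

(** The range of [f] enters here: [sin f] is positive between 0 and [pi]. *)
Lemma b_neq0 : b != 0.
Proof.
rewrite oppr_eq0 expf_eq0 /= /k2 -[0]/(0%:C%C) (inj_eq (@complexI _)).
rewrite gt_eqF // sin_gt0_pi // hf0 (lt_trans hf1) //.
by rewrite ltr_pdivrMr // ltr_pMr ?pi_gt0 // ltr1n.
Qed.

Lemma smooth_Kdisc : smooth Kdisc.
Proof.
apply: smoothD.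
  by under [X in smooth X]eq_fun do rewrite expr2; apply: smoothM; exact: smooth_Ktr.
under [X in smooth X]eq_fun do rewrite -mulrN.
by apply: smoothM; [exact: smooth_cst|exact: smooth_oppKdet].
Qed.

Lemma dense_Kdisc : dense [set x | Kdisc x != 0].
Proof.
apply: dense_ray_poly => x.
(* On the line through [x], the trace is [s^2 (a q2^2 + c q1^2) + b] and the determinant is
   [s^2 a b q2^2]; at [s = 0] the discriminant is [b^2]. *)
exists (((a * q2 x ^+ 2 + c * q1 x ^+ 2)%:P * 'X ^+ 2 + b%:P) ^+ 2
   - (4 * a * b * q2 x ^+ 2)%:P * 'X ^+ 2).
  apply/eqP => /(congr1 (fun p => p.[0])).
  rewrite !hornerE /= !mulr0 add0r subr0 => /eqP.
  by rewrite expf_eq0 /= (negPf b_neq0).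
move=> s; rewrite !hornerE /= /Kdisc /Ktr /Kdet /q1 /q2 /= !mxE !rmorphM /=.
by rewrite -/a -/b -/c /a; ring.
Qed.

Lemma KdiscE x : Kdisc x =
  (Ke g2 f x 0 0 - Ke g2 f x 1 1) ^+ 2 + 4 * Ke g2 f x 0 1 * Ke g2 f x 1 0.
Proof. by rewrite KeE !mxE /= /Kdisc /Ktr /Kdet -/a -/b -/c; ring. Qed.

(** If [F0 + F1 K = 0], then [F1] annihilates the off-diagonal entries of [K] and the differences of
    its diagonal entries, hence [Kdisc] by [KdiscE]. So [F1] vanishes on a dense set, thus
    everywhere, and then so does [F0]. *)
Lemma independent_Ke : independent (generators g2 f).
Proof.
move=> F sF H.
have {}H x i j : F 0 x * (i == j)%:R + F 1 x * Ke g2 f x i j = 0.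
  have /matrixP/(_ i j) := H x.
  by rewrite !big_ord_recl big_ord0 /= !mxE addr0 (_ : lift _ _ = 1) //; exact: val_inj.
have F1 : forall x, F 1 x = 0.
  apply: (smooth_dense_eq0 _ _ _ (sF 1) dense_Kdisc) => x /= dx.
  have := H x 0 0; have := H x 0 1; have := H x 1 0; have := H x 1 1.
  rewrite !eqxx /= !mulr1 !mulr0 !add0r => E11 E10 E01 E00.
  apply/eqP; have : F 1 x * Kdisc x = 0.
    rewrite KdiscE mulrDr.
    have -> : F 1 x * (Ke g2 f x 0 0 - Ke g2 f x 1 1) ^+ 2 =
       ((F 0 x + F 1 x * Ke g2 f x 0 0) - (F 0 x + F 1 x * Ke g2 f x 1 1)) *
       (Ke g2 f x 0 0 - Ke g2 f x 1 1) by ring.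
    rewrite E00 E11 subrr mul0r add0r.
    have -> : F 1 x * (4 * Ke g2 f x 0 1 * Ke g2 f x 1 0) =
       F 1 x * Ke g2 f x 0 1 * (4 * Ke g2 f x 1 0) by ring.
    by rewrite E01 mul0r.
  by move/eqP; rewrite mulf_eq0 (negPf dx) orbF.
move=> i x; have F0 : F 0 x = 0 by have := H x 0 0; rewrite F1 mul0r addr0 eqxx mulr1.
case: i => [[|[|//]] lti].
  by rewrite (_ : Ordinal lti = 0) //; exact: val_inj.
by rewrite (_ : Ordinal lti = 1) //; exact: val_inj.
Qed.

(** Over the complex numbers [X^2 - t X + d] has roots [r] and [s] whose difference is a square root
    of [Kdisc x], so they are distinct. *)
Lemma Ke_diagonalizable x : Kdisc x != 0 ->
  exists P d, P \in unitmx /\ Ke g2 f x = invmx P *m diag_mx d *m P.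
Proof.
move=> dx; have [w w2] : exists w, w ^+ 2 = Kdisc x.
  by exists (sqrtC (Kdisc x)); rewrite sqrtCK.
pose r := (Ktr _ g2 f x + w) / 2; pose s := (Ktr _ g2 f x - w) / 2.
have n2 : (2 : R[i]) != 0 by rewrite pnatr_eq0.
apply: (@diagonalizable_quadratic _ _ _ r s).
  rewrite -subr_eq0 (_ : r - s = w); last by rewrite /r /s; field.
  by apply: contraNneq dx => w0; rewrite -w2 w0 expr0n.
have rs1 : r + s = Ktr _ g2 f x by rewrite /r /s; field.
have rs2 : r * s = Kdet _ g2 f x.
  rewrite (_ : r * s = (Ktr _ g2 f x ^+ 2 - w ^+ 2) / 4); last by rewrite /r /s; field.
  by rewrite w2 /Kdisc; field.
have := Ke_sqr _ g2 f x; rewrite -rs1 -rs2; move: (Ke g2 f x) => M MM.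
rewrite mulmxBl !mulmxBr MM -scalar_mxM mul_scalar_mx mul_mx_scalar.
by apply/matrixP => i j; rewrite !mxE; case: (i == j); rewrite ?mulr1n ?mulr0n; ring.
Qed.

(** A basis diagonalizing [Ke] at [x] diagonalizes every [F + G K] there, so one dense open set
    serves the whole algebra. *)
Lemma gen_semisimple : semisimple_algebra (gen_algebra (range (generators g2 f))).
Proof.
exists [set x | Kdisc x != 0]; split.
- exact/open_smooth_neq0/smooth_Kdisc.
- exact: dense_Kdisc.
move=> K /gen_algebraP[F [G [_ _ ->]]] x /Ke_diagonalizable[P [d [uP KP]]].
have -> : span1 _ F G (Ke g2 f) x =
    invmx P *m diag_mx (const_mx (F x) + G x *: d) *m P.
  rewrite /span1 KP linearD linearZ /= diag_const_mx mulmxDr mulmxDl.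
  rewrite scalar_mxC -[_ *m invmx P *m P]mulmxA mulVmx // mulmx1.
  by rewrite -scalemxAr -scalemxAl.
by move=> l _; exact: mup_char_poly_diag_conj.
Qed.

End Discriminant.

Theorem proposition3 (R : realType) (g1 g2 : R[i]) (f : R)
    (hg1 : real_or_imaginary g1) (hg2 : real_or_imaginary g2)
    (hf0 : 0 < f) (hf1 : f < pi / 2) :
  let K := Ke g2 f in
  let B := generators g2 f in
  let A := gen_algebra (range B) in
  haantjes_operator K /\
  [/\ omegaH_structure B A,
      semisimple_algebra A,
      abelian_algebra A &
      chain_equation K (H2 g1 g2) (Ie g1 g2 f)].
Proof.
move=> K B A; split.
  by apply: haantjes_operatorP; [exact: smooth_Ke|exact: htorsion_Ke].
split.
- split; last exact: gen_omega.
  split.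
  + exact: gen_haantjes.
  + by split; [exact: gen_lincomb|exact: gen_comp].
  + exact: gen_generators.
  + exact: independent_Ke.
  + move=> L /gen_algebraP[F [G [sF sG ->]]].
    exists (fun i : 'I_2 => if i == 0 then F else G); first by move=> i; case: ifP.
    by move=> x; rewrite !big_ord_recl big_ord0 /= addr0 scalemx1.
- exact: gen_semisimple.
- exact: gen_abelian.
- exact: chain_Ke.
Qed.
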